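(* Let $\mathbf{W}_{up}\in\mathbb{R}^{D\times d}$, $\mathbf{W}_{down}\in\mathbb{R}^{d\times D}$, and let $\mathsf{F}(\mathbf{x})=\mathbf{W}_{down}\,\sigma^*(\mathbf{W}_{up}\mathbf{x})$, where $\sigma^*$ is the entrywise application of the $\tanh$-approximation of the GELU function $$\sigma(x)=\frac{x}{2}\Big[1+\tanh\Big(\sqrt{\tfrac{2}{\pi}}\,(x+0.044715\,x^3)\Big)\Big].$$ For every $\mathbf{x}\in\mathbb{R}^d$, the value of $\mathsf{F}(\mathbf{x})$ computed in floating-point arithmetic satisfies (entrywise) $$|\mathsf{fl}(\mathsf{F}(\mathbf{x}))-\mathsf{F}(\mathbf{x})|\le\Big(\tfrac{21}{4}\mathsf{u}_w+\tfrac92\mathsf{u}_q+\tfrac54\gamma_{MM}(d)+\gamma_{MM}(D)+\mathcal{O}(\mathsf{u}_q^2)\Big)|\mathbf{W}_{down}||\mathbf{W}_{up}||\mathbf{x}|.$$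
   Context: Absolute values and inequalities of vectors/matrices are entrywise; $\mathsf{fl}(\cdot)$ denotes the computed value. Floating-point model. There are unit round-offs $\mathsf{u}_w\le\mathsf{u}_a\ll\mathsf{u}_q$ (working, accumulation, quantisation precision). In working precision every arithmetic operation and every elementary function (here including $\tanh$) returns the exact result for its actual operands multiplied by $1+\delta$, $|\delta|\le\mathsf{u}_w$. A matrix product with operands $\mathbf{W}\in\mathbb{R}^{m\times k}$, $\mathbf{X}\in\mathbb{R}^{k\times n}$ is computed with error $$|\mathsf{fl}(\mathbf{W}\mathbf{X})-\mathbf{W}\mathbf{X}|\le\big(\gamma_{MM}(k)+\gamma(2,\mathsf{u}_q)+\gamma_{MM}(k)\gamma(2,\mathsf{u}_q)\big)|\mathbf{W}||\mathbf{X}|,$$ where $\gamma(n,\mathsf{u})=n\mathsf{u}/(1-n\mathsf{u})$ and $\gamma_{MM}(k)=\gamma_{MM}(k,\mathsf{u}_a)\ge0$ is a constant depending on the summation algorithm, of first order in $\mathsf{u}_a$ (e.g. $\gamma(k,\mathsf{u}_a)$ for recursive summation). Algorithm: $\mathbf{W}_{up}\mathbf{x}$ is computed as a matrix product; $\sigma$ is evaluated entrywise in working precision following its formula, i.e. $\sqrt{2/\pi}\,(y+0.044715\,y^3)$ with five operations (constants are taken as exact), then $\tanh$, addition of $1$, and multiplication by $y/2$; finally the matrix product with $\mathbf{W}_{down}$ is computed. Each step acts on the computed result of the previous one. $\mathcal{O}(\mathsf{u}_q^2)$ is as $\mathsf{u}_q\to0$ with $\mathbf{x}$ and the weights fixed.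 *)

(* Defs.v *)
From mathcomp Require Import all_boot all_order all_algebra.
From mathcomp Require Import all_classical all_reals all_analysis.

Set Implicit Arguments.
Unset Strict Implicit.
Unset Printing Implicit Defensive.

Import Order.TTheory GRing.Theory Num.Theory.
Import numFieldNormedType.Exports.

Local Open Scope ring_scope.

Definition tanh (R : realType) (t : R) : R :=
  (expR t - expR (- t)) / (expR t + expR (- t)).

(* 0.044715, split so as to avoid a large unary literal *)
Definition gelu_cubic (R : realType) : R := (44 * 10 ^+ 3 + 715) / 10 ^+ 6.

Definition gelu (R : realType) (y : R) : R :=
  y / 2 * (1 + tanh (Num.sqrt (2 / pi) * (y + gelu_cubic R * y ^+ 3))).

Definition mlp (R : realType) (d D : nat) (Wup : 'M[R]_(D, d))
    (Wdown : 'M[R]_(d, D)) (x : 'cV[R]_d) : 'cV[R]_d :=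
  Wdown *m map_mx (@gelu R) (Wup *m x).

(* Entrywise absolute value; `|A| is a matrix norm in MathComp-Analysis. *)
Definition absmx (R : realType) (m n : nat) (A : 'M[R]_(m, n)) : 'M[R]_(m, n) :=
  map_mx (fun a : R => `|a|) A.

Definition gamma (R : realType) (n : nat) (u : R) : R :=
  n%:R * u / (1 - n%:R * u).

(* The arithmetic is modelled by relations between the actual operands of an
   operation and its computed result z, rather than by a fixed rounding
   function, so that nothing beyond the stated error bounds is assumed. *)
Definition fl_op (R : realType) (uw : R) (exact z : R) : Prop :=
  exists2 delta : R, `|delta| <= uw & z = exact * (1 + delta).

(* gk stands for gamma_MM(k, u_a), k being the inner dimension. *)
Definition fl_mulmx (R : realType) (gk uq : R) (m k n : nat)
    (W : 'M[R]_(m, k)) (X : 'M[R]_(k, n)) (Z : 'M[R]_(m, n)) : Prop :=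
  forall i j,
    absmx (Z - W *m X) i j <=
      (gk + gamma 2 uq + gk * gamma 2 uq) * (absmx W *m absmx X) i j.

(* The constants sqrt (2 / pi) and 0.044715 are exact. The halving of y is an
   operation like any other; delta = 0 is allowed, so this includes the case
   of an exact halving. *)
Definition fl_gelu (R : realType) (uw : R) (y z : R) : Prop :=
  exists y2 y3 c s t th p h : R,
    [/\ fl_op uw (y * y) y2,
        fl_op uw (y2 * y) y3,
        fl_op uw (gelu_cubic R * y3) c,
        fl_op uw (y + c) s &
        fl_op uw (Num.sqrt (2 / pi) * s) t] /\
    [/\ fl_op uw (tanh t) th,
        fl_op uw (1 + th) p,
        fl_op uw (y / 2) h &
        fl_op uw (h * p) z].

Definition fl_mlp (R : realType) (gMM : nat -> R -> R) (uw ua uq : R)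
    (d D : nat) (Wup : 'M[R]_(D, d)) (Wdown : 'M[R]_(d, D))
    (x z : 'cV[R]_d) : Prop :=
  exists y a : 'cV[R]_D,
    [/\ fl_mulmx (gMM d ua) uq Wup x y,
        forall i j, fl_gelu uw (y i j) (a i j) &
        fl_mulmx (gMM D ua) uq Wdown a z].

(* Main.v *)
(* Three facts about the activation carry the bound: it is 5/4-Lipschitz, it
   satisfies |gelu y| <= |y|, and its evaluation has error at most
   (21/4) u_w |y|.  The first product then contributes
   (5/4) (gamma_MM(d) + 2 u_q), the second gamma_MM(D) + 2 u_q, and the
   activation (21/4) u_w, up to products of two such terms.
   In the evaluation, the argument t of tanh carries a relative error of about
   5 u_w, which tanh damps because |t| sech^2 t <= 3/5; with the error of tanh
   itself and those of the three operations after it, the total is about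
   5.05 u_w |y|.  The slack below 21/4 absorbs all higher-order terms in u_w,
   so this estimate is uniform in y. *)
Require Import Defs.
From mathcomp Require Import all_boot all_order all_algebra.
From mathcomp Require Import all_classical all_reals all_analysis.
From mathcomp Require Import ring lra.

Import Order.TTheory GRing.Theory Num.Theory.
Import numFieldNormedType.Exports.

Local Open Scope classical_set_scope.
Local Open Scope ring_scope.

(** Writing the intermediate point as [a + th * (b - a)] keeps the formula valid whatever the order
    of [a] and [b]; for [b < a], [th] becomes [1 - th]. *)
Lemma MVT_everywhere (R : realType) (f df : R -> R) (a b : R) :
    (forall x : R, is_derive x 1 f (df x)) ->
  exists2 th : R, 0 <= th <= 1 & f b - f a = df (a + th * (b - a)) * (b - a).
Proof.
move=> fdf.
have segP p q : p < q ->
    exists2 th : R, 0 <= th <= 1 & f q - f p = df (p + th * (q - p)) * (q - p).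
  move=> pq; have [] := @MVT_segment R f df p q (ltW pq) (fun x _ => fdf x).
    by apply: derivable_within_continuous => x _; have [] := fdf x.
  move=> c; rewrite in_itv /= => /andP[pc cq] ->.
  have qp0 : 0 < q - p by rewrite subr_gt0.
  exists ((c - p) / (q - p)).
    apply/andP; split; first by rewrite divr_ge0 ?(ltW qp0)// subr_ge0.
    by rewrite ler_pdivrMr// mul1r lerB.
  by rewrite divfK ?gt_eqF// subrKC.
have [ab|ba|->] := ltgtP a b.
- exact: segP.
- have [th th01 E] := segP _ _ ba.
  exists (1 - th); first by lra.
  have -> : a + (1 - th) * (b - a) = b + th * (a - b) by ring.
  by rewrite -[LHS]opprB E -mulrN opprB.
- by exists 0; rewrite ?lexx ?ler01// !subrr mulr0.
Qed.

(** * Bounds on tanh and its derivative *)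

Section tanh.
Variable R : realType.
Implicit Types t w : R.

Lemma tanh_den_gt0 t : 0 < expR t + expR (- t).
Proof. by rewrite addr_gt0 ?expR_gt0. Qed.

Lemma tanhN t : tanh (- t) = - tanh t.
Proof.
by rewrite /tanh opprK -mulNr opprB [expR (- t) + expR t]addrC.
Qed.

Lemma one_sub_tanh2 t : 1 - tanh t ^+ 2 = 4 / (expR t + expR (- t)) ^+ 2.
Proof.
have h := tanh_den_gt0 t.
have E : expR t * expR (- t) = 1 by rewrite expRN divff ?gt_eqF ?expR_gt0.
rewrite /tanh exprMn exprVn.
(* Homogenising [4] by e^t e^(-t) = 1 leaves a rational identity in the two exponentials. *)
have -> : (4 : R) = 4 * (expR t * expR (- t)) by rewrite E mulr1.
by field; rewrite gt_eqF.
Qed.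

Lemma tanh_le1 t : `|tanh t| <= 1.
Proof.
rewrite -(@ler_pXn2r _ 2)// ?nnegrE// expr1n real_normK ?num_real//.
by rewrite -subr_ge0 one_sub_tanh2 divr_ge0// sqr_ge0.
Qed.

Lemma tanh_ge0 t : 0 <= t -> 0 <= tanh t.
Proof.
move=> t0; rewrite divr_ge0 ?(ltW (tanh_den_gt0 t))// subr_ge0 ler_expR; lra.
Qed.

Lemma is_derive_tanh t : is_derive t 1 (@tanh R) (1 - tanh t ^+ 2).
Proof.
have h := tanh_den_gt0 t.
have dV : is_derive t 1 (fun t => (expR t + expR (- t))^-1)
    (- (expR t + expR (- t)) ^- 2 *: (expR t - expR (- t))).
  apply: is_deriveV; first by rewrite gt_eqF.
  by apply: is_derive_eq; rewrite mulrN1.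
rewrite one_sub_tanh2 /tanh; apply: is_derive_eq.
have -> : (4 : R) = 4 * (expR t * expR (- t)).
  by rewrite expRN divff ?gt_eqF ?expR_gt0// mulr1.
by rewrite /GRing.scale /=; field; rewrite gt_eqF.
Qed.

(** This is 1 + v <= e^v at v = 2t/(n+1), raised to the power n+1; it gives polynomial minorants of
    e^(2t). *)
Lemma expR2_ge t (n : nat) : 0 <= t -> (1 + 2 * t / n.+1%:R) ^+ n.+1 <= expR (2 * t).
Proof.
move=> t0.
have -> : expR (2 * t) = expR (2 * t / n.+1%:R) ^+ n.+1.
  by rewrite -expRM_natl -mulr_natl [_ * (_ / _)]mulrC divfK// pnatr_eq0.
apply: lerXn2r; rewrite ?nnegrE ?expR_ge0 ?expR_ge1Dx//.
by rewrite addr_ge0// divr_ge0// mulr_ge0.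
Qed.

Lemma normr_mul_one_sub_tanh2 t : `|t| * (1 - tanh t ^+ 2) <= 3 / 5.
Proof.
wlog t0 : t / 0 <= t.
  move=> H; have [/H//|/ltW t0] := leP 0 t.
  by rewrite -normrN -[tanh t]opprK -tanhN sqrrN H// oppr_ge0.
rewrite ger0_norm// one_sub_tanh2 mulrA ler_pdivrMr ?exprn_gt0 ?tanh_den_gt0//.
have E2 : expR t * expR (- t) = 1 by rewrite expRN divff ?gt_eqF ?expR_gt0.
have b2 : 0 <= expR (- t) ^+ 2 by rewrite sqr_ge0.
have := expR2_ge t 3 t0; rewrite expRM_natl => a2.
have -> : (expR t + expR (- t)) ^+ 2 = expR t ^+ 2 + 2 + expR (- t) ^+ 2.
  by rewrite sqrrD E2.
have a2' : (1 + 2 * t / 4) ^+ 4 = ((1 + t / 2) ^+ 2) ^+ 2 by field.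
rewrite {}a2' in a2.
(* Both squares vanish at t = 1. They place (1 + t/2)^4 above its tangent 27t/4 - 27/16 there, which
   suffices for 20t/3 <= (1 + t/2)^4 + 2. *)
have sq := sqr_ge0 ((1 + t / 2) ^+ 2 - 9 / 4).
have sq2 := sqr_ge0 (t - 1).
nra.
Qed.

(* In terms of E = e^(2t), the upper bound reads 8 w <= E + 6 + 5 / E. *)
Lemma tanhD_sech2M_le t w : 0 <= t -> 0 <= w -> w <= t + 9 / 50 * t ^+ 3 ->
  0 <= tanh t + (1 - tanh t ^+ 2) * w <= 3 / 2.
Proof.
move=> t0 w0 wt.
have h := tanh_den_gt0 t.
have E2 : expR t * expR (- t) = 1 by rewrite expRN divff ?gt_eqF ?expR_gt0.
rewrite addr_ge0 ?tanh_ge0//=; last first.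
  by rewrite mulr_ge0// one_sub_tanh2 divr_ge0// sqr_ge0.
rewrite one_sub_tanh2.
have -> : tanh t + 4 / (expR t + expR (- t)) ^+ 2 * w =
    (expR t ^+ 2 - expR (- t) ^+ 2 + 4 * w) / (expR t + expR (- t)) ^+ 2.
  by rewrite /tanh; field; rewrite gt_eqF.
rewrite ler_pdivrMr ?exprn_gt0//.
have -> : (expR t + expR (- t)) ^+ 2 = expR t ^+ 2 + 2 + expR (- t) ^+ 2.
  by rewrite sqrrD E2.
have b2 : 0 <= expR (- t) ^+ 2 by rewrite sqr_ge0.
have := expR2_ge t 7 t0; rewrite expRM_natl => a2.
suff : 8 * w <= expR t ^+ 2 + 6 by lra.
apply: le_trans (lerD a2 (lexx _)).
have := wt.
have -> : 2 * t / 8 = t / 4 by field.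
have -> : t = 4 * (t / 4) by field.
have : 0 <= t / 4 by rewrite divr_ge0.
rewrite [4 * (t / 4) / 4]mulrAC divff ?pnatr_eq0// mul1r.
move: (t / 4) => s s0 ws.
(* In (1 + s)^8 + 6 - 8w only the cubic and linear terms can be negative: [13 / 50] nearly completes
   the square of 70 s^4 - 36.16 s^3, and [1 / 2] is near the vertex of the quadratic that is
   left. *)
have sq := mulr_ge0 (sqr_ge0 s) (sqr_ge0 (s - 13 / 50)).
have sq2 := sqr_ge0 (s - 1 / 2).
have s5 := exprn_ge0 5 s0; have s6 := exprn_ge0 6 s0.
have s7 := exprn_ge0 7 s0; have s8 := exprn_ge0 8 s0.
nra.
Qed.
End tanh.

(** * Lipschitz and growth bounds for GELU *)

Section gelu.
Variable R : realType.
Implicit Types c k y : R.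

Lemma gelu_cubic_bounds : 0 <= gelu_cubic R <= 9 / 200.
Proof. by rewrite /gelu_cubic; lra. Qed.

Lemma sqr_sqrt_2_div_pi_ge : 1 / 2 <= Num.sqrt (2 / pi : R) ^+ 2.
Proof.
have p := pi_gt0 R; have := pihalf_lt2 R.
by rewrite sqr_sqrtr ?divr_ge0 ?pi_ge0// ler_pdivlMr//; lra.
Qed.

(** With t = c (y + k y^3), the expression is the derivative of y tanh t, since y t' = c (y + 3 k
    y^3). *)
Lemma tanh_cubic_deriv_bound c k y :
    0 <= c -> 1 / 2 <= c ^+ 2 -> 0 <= k <= 9 / 200 ->
  `|tanh (c * (y + k * y ^+ 3)) + (1 - tanh (c * (y + k * y ^+ 3)) ^+ 2) *
     (c * (y + 3 * k * y ^+ 3))| <= 3 / 2.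
Proof.
move=> c0 c2 /andP[k0 k1].
wlog y0 : y / 0 <= y.
  move=> H; have [/H//|/ltW y0] := leP 0 y.
  have := H (- y); rewrite oppr_ge0 => /(_ y0); rewrite -[X in X <= _ -> _]normrN.
  rewrite [c * (- y + _)](_ : _ = - (c * (y + k * y ^+ 3))); last by ring.
  rewrite tanhN sqrrN [c * (- y + _)](_ : _ = - (c * (y + 3 * k * y ^+ 3))); last by ring.
  by rewrite mulrN -opprD opprK.
have y3 : 0 <= y ^+ 3 by rewrite exprn_ge0.
have cy3 : 0 <= c * y ^+ 3 by rewrite mulr_ge0.
have ky3 : 0 <= k * y ^+ 3 by rewrite mulr_ge0.
have t0 : 0 <= c * (y + k * y ^+ 3) by rewrite mulr_ge0 ?addr_ge0.
have w0 : 0 <= c * (y + 3 * k * y ^+ 3).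
  by rewrite -[3 * k * _]mulrA mulr_ge0 ?addr_ge0 ?mulr_ge0.
(* Here y t' = t + 2 k c y^3, and 2 k <= 9/100 <= (9/50) c^2 bounds the excess by (9/50) (c y)^3 <=
   (9/50) t^3. *)
suff wt : c * (y + 3 * k * y ^+ 3) <=
    c * (y + k * y ^+ 3) + 9 / 50 * (c * (y + k * y ^+ 3)) ^+ 3.
  by have /andP[h1 h2] := tanhD_sech2M_le _ _ _ t0 w0 wt; rewrite ger0_norm.
rewrite [leLHS](_ : _ = c * (y + k * y ^+ 3) + 2 * k * (c * y ^+ 3)); last by ring.
rewrite lerD2l.
apply: (@le_trans _ _ (9 / 50 * (c * y) ^+ 3)).
  rewrite [(c * y) ^+ 3](_ : _ = c ^+ 2 * (c * y ^+ 3)); last by ring.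
  nra.
rewrite ler_wpM2l; [by []| lra |].
apply: lerXn2r; rewrite ?nnegrE ?t0 ?mulr_ge0//.
by rewrite ler_wpM2l// lerDl.
Qed.

Lemma is_derive_mul_tanh_cubic c k y :
  is_derive y 1 (fun y => y / 2 * (1 + tanh (c * (y + k * y ^+ 3))))
    (1 / 2 + (tanh (c * (y + k * y ^+ 3)) +
      (1 - tanh (c * (y + k * y ^+ 3)) ^+ 2) * (c * (y + 3 * k * y ^+ 3))) / 2).
Proof.
have dp : is_derive y 1 (fun y => c * (y + k * y ^+ 3)) (c * (1 + 3 * k * y ^+ 2)).
  apply: is_derive_eq; rewrite /GRing.scale /=. ring.
have dT : is_derive y 1 (fun y => tanh (c * (y + k * y ^+ 3))) _ :=
  @is_derive1_comp R (@tanh R) _ y _ _ (is_derive_tanh _ _) dp.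
apply: is_derive_eq; rewrite /GRing.scale /=. rewrite !mulr0; by field.
Qed.

(** The derivative is 1/2 plus half of a quantity bounded by 3/2, and 1/2 + 3/4 = 5/4. *)
Lemma gelu_lipschitz (a b : R) : `|gelu b - gelu a| <= 5 / 4 * `|b - a|.
Proof.
have [th _ ->] := MVT_everywhere R _ _ a b
  (is_derive_mul_tanh_cubic (Num.sqrt (2 / pi)) (gelu_cubic R)).
rewrite normrM ler_wpM2r//.
have := tanh_cubic_deriv_bound _ _ (a + th * (b - a)) (sqrtr_ge0 _)
  sqr_sqrt_2_div_pi_ge gelu_cubic_bounds.
by rewrite !ler_norml; lra.
Qed.

Lemma gelu_norm_le y : `|gelu y| <= `|y|.
Proof.
rewrite /gelu normrM normrM [`|2^-1|]ger0_norm ?invr_ge0// -mulrA ler_piMr//.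
have := tanh_le1 R (Num.sqrt (2 / pi) * (y + gelu_cubic R * y ^+ 3)).
by rewrite ler_norml => ?; rewrite ger0_norm; lra.
Qed.
End gelu.

(** * Rounding errors in the evaluation of GELU *)

Section fl_gelu.
Variable R : realType.
Implicit Types t y z u eta : R.

(** At the intermediate point t (1 + th eta), sech^2 is at most 3/5 over its modulus, which is at
    least |t| (1 - |eta|); the factor |t| cancels, so the bound is uniform in t. *)
Lemma tanh_rel_perturbation t eta : `|eta| < 1 ->
  `|tanh (t * (1 + eta)) - tanh t| <= 3 / 5 * `|eta| / (1 - `|eta|).
Proof.
move=> eta1.
have [th /andP[th0 th1] ->] :=
  MVT_everywhere R _ _ t (t * (1 + eta)) (is_derive_tanh R).
rewrite [t * (1 + eta) - t](_ : _ = t * eta); last by ring.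
rewrite [t + _](_ : _ = t * (1 + th * eta)); last by ring.
rewrite ler_pdivlMr ?subr_gt0//.
have := normr_mul_one_sub_tanh2 R (t * (1 + th * eta)).
have s0 : 0 <= 1 - tanh (t * (1 + th * eta)) ^+ 2.
  by rewrite one_sub_tanh2 divr_ge0// sqr_ge0.
rewrite !normrM (ger0_norm s0) => h.
have h1 : 1 - `|eta| <= `|1 + th * eta|.
  apply: le_trans (lerB_normD _ _); rewrite normr1 lerB// normrM ger0_norm//.
  by rewrite ler_piMl.
apply: le_trans (ler_wpM2r (normr_ge0 eta) h).
set S := 1 - _ in s0 h *.
rewrite [leLHS](_ : _ = (1 - `|eta|) * (`|t| * S * `|eta|)); last by ring.
rewrite [leRHS](_ : _ = `|1 + th * eta| * (`|t| * S * `|eta|)); last by ring.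
by rewrite ler_wpM2r// !mulr_ge0.
Qed.

(** Accumulates rounding factors one at a time: [u <= 1 / 1000] absorbs the cross term, so the bound
    stays linear in [u]. *)
Lemma rel_errorM (a b A B u : R) : u <= 1 / 1000 ->
    `|a| <= A * u -> `|b| <= u -> A * (1 + 1 / 1000) + 1 <= B ->
  `|(1 + a) * (1 + b) - 1| <= B * u.
Proof.
move=> u1 aA bu AB.
rewrite [_ - 1](_ : _ = a + b + a * b); last by ring.
have ab : `|a * b| <= A * u * (1 / 1000).
  by rewrite normrM ler_pM// (le_trans bu).
have u0 : 0 <= u by apply: le_trans bu.
apply: le_trans (ler_normD _ _) _.
apply: le_trans (lerD (ler_normD _ _) (lexx _)) _.
nra.
Qed.

(** The terms y and k y^3 have the same sign, so no cancellation occurs: [e] is damped by the weight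
    k y^2 / (1 + k y^2) in [0, 1). *)
Lemma add_cubic_rel_error k y e : 0 <= k ->
  exists2 e', `|e'| <= `|e| & y + k * y ^+ 3 * (1 + e) = (y + k * y ^+ 3) * (1 + e').
Proof.
move=> k0; have ky0 : 0 <= k * y ^+ 2 by rewrite mulr_ge0 ?sqr_ge0.
have d0 : 0 < 1 + k * y ^+ 2 by rewrite ltr_pwDl.
exists (k * y ^+ 2 / (1 + k * y ^+ 2) * e); last by field; rewrite gt_eqF.
rewrite normrM ler_piMl// ger0_norm ?divr_ge0 ?(ltW d0)//.
by rewrite ler_pdivrMr// mul1r lerDr.
Qed.

Lemma fl_gelu_error u y z : u <= 1 / 1000 -> fl_gelu u y z ->
  `|z - gelu y| <= 21 / 4 * u * `|y|.
Proof.
move=> u1 [y2 [y3 [c [s [t [th [p [h [[]]]]]]]]]].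
move=> [d1 d1u ->] [d2 d2u ->] [d3 d3u ->] [d4 d4u ->] [d5 d5u ->].
move=> [[d6 d6u ->] [d7 d7u ->] [d8 d8u ->] [d9 d9u ->]].
have u0 : 0 <= u by apply: le_trans d1u.
(* Each rounding adds slightly more than 1 to the constant: 1, 2.01, 3.02, and further on 4.03 and
   5.04. *)
have [e3 e3u e3E] : exists2 e, `|e| <= 302 / 100 * u &
    (1 + d1) * (1 + d2) * (1 + d3) = 1 + e.
  exists ((1 + d1) * (1 + d2) * (1 + d3) - 1); last by ring.
  rewrite -[(1 + d1) * _](subrKC 1).
  apply: (@rel_errorM _ _ (201 / 100)) => //; last by lra.
  by apply: (@rel_errorM _ _ 1) => //; rewrite ?mul1r//; lra.
have [e3' e3'u e3'E] : exists2 e, `|e| <= 302 / 100 * u &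
    (1 + d7) * (1 + d8) * (1 + d9) = 1 + e.
  exists ((1 + d7) * (1 + d8) * (1 + d9) - 1); last by ring.
  rewrite -[(1 + d7) * _](subrKC 1).
  apply: (@rel_errorM _ _ (201 / 100)) => //; last by lra.
  by apply: (@rel_errorM _ _ 1) => //; rewrite ?mul1r//; lra.
have /andP[k0 _] := gelu_cubic_bounds R.
rewrite /gelu; move: (Num.sqrt _) (gelu_cubic R) k0 => c0 k k0.
have [e4 e4e3 e4E] := add_cubic_rel_error k y e3 k0.
set t0 := c0 * (y + k * y ^+ 3).
have [eta etau ->] : exists2 eta, `|eta| <= 504 / 100 * u &
    c0 * ((y + k * (y * y * (1 + d1) * y * (1 + d2)) * (1 + d3)) * (1 + d4)) *
      (1 + d5) = t0 * (1 + eta).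
  exists ((1 + e4) * (1 + d4) * (1 + d5) - 1).
    rewrite -[(1 + e4) * _](subrKC 1).
    apply: (@rel_errorM _ _ (403 / 100)) => //; last by lra.
    apply: (@rel_errorM _ _ (302 / 100)) => //; last by lra.
    exact: le_trans e3u.
  rewrite subrKC.
  rewrite [y + _](_ : _ = y + k * y ^+ 3 * ((1 + d1) * (1 + d2) * (1 + d3)));
    last by ring.
  by rewrite e3E e4E /t0; ring.
(* (3/5) 5.04 = 3.024; the margin up to 3.05 pays for the division by 1 - |eta|. *)
have tau : `|tanh (t0 * (1 + eta)) - tanh t0| <= 305 / 100 * u.
  have eta1 : `|eta| <= 1 / 100 by lra.
  apply: le_trans (tanh_rel_perturbation _ _ _) _; first by lra.
  rewrite ler_pdivrMr; nra.
have T1 := tanh_le1 R (t0 * (1 + eta)); have T2 := tanh_le1 R t0.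
move: (tanh _) (tanh _) T1 T2 tau => T T' T'1 T1 tau.
have Td : `|T' * d6| <= u by rewrite normrM -[leRHS]mul1r ler_pM.
(* The three summands come from the argument of tanh, from tanh itself and from the last three
   operations; half of 3.05 + 1 + 3.02 * 2.001 is about 5.05. *)
rewrite [_ - _](_ : _ =
    y * (((T' - T) + T' * d6 + e3' * (1 + T' + T' * d6)) / 2)); last first.
  have -> : e3' = (1 + d7) * (1 + d8) * (1 + d9) - 1 by rewrite e3'E; ring.
  by field.
rewrite normrM mulrC ler_wpM2r//.
rewrite normrM [`|2^-1|]ger0_norm ?invr_ge0// ler_pdivrMr//.
have E : `|e3' * (1 + T' + T' * d6)| <= 302 / 100 * u * (2 + 1 / 1000).
  rewrite normrM ler_pM//.
  by move: T'1 Td; rewrite !ler_norml; lra.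
apply: le_trans (ler_normD _ _) _.
apply: le_trans (lerD (ler_normD _ _) (lexx _)) _.
lra.
Qed.
End fl_gelu.

(** * Asymptotics at 0 from the right *)

(** An explicit radius lets the hypotheses on [gMM] be used at [ua], while the limit is taken in
    [uq]. *)
Lemma near_right0_ex (R : realType) (P : R -> Prop) :
  (\forall u \near 0^'+, P u) -> exists2 r, 0 < r & forall u, 0 < u -> u < r -> P u.
Proof.
move=> [r r0 rP]; exists r => // u u0 ur; apply: rP => //=.
by rewrite sub0r normrN gtr0_norm.
Qed.

Lemma scale_sqr_eqO (R : realType) (K : R) :
  (fun u : R => K * u ^+ 2) =O_ (0^'+) (fun u => u ^+ 2).
Proof.
(* The added 1 keeps the constant positive when [K] is 0. *)
apply/eqO_exP; exists (`|K| + 1); first by rewrite ltr_pwDr.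
by apply: nearW => u; rewrite normrM ler_wpM2r// lerDl.
Qed.

(** * Entrywise bounds for matrix products *)

Section absmx.
Variables (R : realType) (m k n : nat).

Lemma absmx_ge0 (A : 'M[R]_(m, n)) i j : 0 <= absmx A i j.
Proof. by rewrite mxE. Qed.

Lemma absmx_mulmx_le (A : 'M[R]_(m, k)) (B : 'M[R]_(k, n)) i j :
  absmx (A *m B) i j <= (absmx A *m absmx B) i j.
Proof.
rewrite !mxE; apply: le_trans (ler_norm_sum _ _ _) _.
by apply: ler_sum => l _; rewrite normrM !mxE.
Qed.

Lemma absmx_mulmx_ler (A : 'M[R]_(m, k)) (B V : 'M[R]_(k, n)) (b : R) i j :
    (forall l, absmx B l j <= b * V l j) ->
  (absmx A *m absmx B) i j <= b * (absmx A *m V) i j.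
Proof.
move=> BV; rewrite !mxE mulr_sumr; apply: ler_sum => l _.
by rewrite !mxE mulrCA ler_wpM2l//; have := BV l; rewrite mxE.
Qed.
End absmx.

(** * Second-order expansion of the composed error *)

Lemma gamma2_bounds (R : realType) (u : R) : 0 <= u -> u <= 1 / 4 ->
  [/\ 0 <= gamma 2 u, gamma 2 u <= 4 * u & gamma 2 u <= 2 * u + 8 * u ^+ 2].
Proof.
move=> u0 u1; have d0 : 0 < 1 - 2 * u by lra.
rewrite /gamma; split; first by rewrite divr_ge0 ?mulr_ge0 ?(ltW d0).
  by rewrite ler_pdivrMr//; nra.
(* The remainder gamma(2, u) - 2u = 4u^2 / (1 - 2u) is at most 8u^2, as 1 - 2u >= 1/2. *)
rewrite ler_pdivrMr// -subr_ge0.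
rewrite [leRHS](_ : _ = 4 * u ^+ 2 * (1 - 4 * u)); last by ring.
by rewrite !mulr_ge0 ?sqr_ge0//; lra.
Qed.

(* e1 and e2 are the relative errors of the two matrix products, beta
   that of the hidden layer; A u bounds e1 and e2, and B u^2 what exceeds
   their first-order parts g1 + 2 u and g2 + 2 u. *)
Lemma mlp_error_expansion (R : realType) (C uw u G g1 g2 : R) :
    0 <= C -> 0 <= uw <= u -> u <= 1 / 4 ->
    [/\ 0 <= G, G <= 4 * u & G <= 2 * u + 8 * u ^+ 2] ->
    0 <= g1 <= C * u -> 0 <= g2 <= C * u ->
  let e1 := g1 + G + g1 * G in
  let e2 := g2 + G + g2 * G in
  let beta := 21 / 4 * uw * (1 + e1) + 5 / 4 * e1 in
  let A := 5 * C + 4 in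
  let B := 4 * C + 8 in
  [/\ 0 <= e1, 0 <= e2, 0 <= beta & e2 * (1 + beta) + beta <=
    21 / 4 * uw + 9 / 2 * u + 5 / 4 * g1 + g2 +
      (B + A * (21 / 4 * (1 + A) + 5 / 4 * A) + 21 / 4 * A + 5 / 4 * B) * u ^+ 2].
Proof.
move=> C0 /andP[uw0 uwu] u1 [G0 G1 G2] /andP[g10 g1C] /andP[g20 g2C] e1 e2 beta A B.
have u0 : 0 <= u by exact: le_trans uwu.
have B0 : 0 <= B by rewrite /B; lra.
have A0 : 0 <= A by rewrite /A; lra.
(* The product [g * G] is at most 4 C u^2, hence at most C u: this gives 5C + 4 in [A], and 4C + 8
   in [B] with the 8 u^2 from [G]. *)
have eb g : 0 <= g -> g <= C * u ->
    [/\ 0 <= g + G + g * G, g + G + g * G <= A * u &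
        g + G + g * G <= g + 2 * u + B * u ^+ 2].
  move=> g0 gC; have gG : g * G <= C * u * (4 * u) by rewrite ler_pM.
  split; first by rewrite !addr_ge0 ?mulr_ge0.
    have : C * u * (4 * u) <= C * u by rewrite ler_piMr ?mulr_ge0//; lra.
    rewrite /A; lra.
  by rewrite /B; lra.
have [e10 e1A e1B] := eb _ g10 g1C; have [e20 e2A e2B] := eb _ g20 g2C.
rewrite -/e1 in e10 e1A e1B; rewrite -/e2 in e20 e2A e2B.
clearbody e1 e2.
have uwe0 : 0 <= uw * e1 by rewrite mulr_ge0.
have beta0 : 0 <= beta by rewrite /beta; lra.
split=> //.
have Au : A * u <= A by rewrite ler_piMr//; lra.
have uwe1 : uw * e1 <= u * (A * u) by rewrite ler_pM.
have betaB : beta <= (21 / 4 * (1 + A) + 5 / 4 * A) * u.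
  have : uw * e1 <= u * A by rewrite ler_pM// (le_trans e1A).
  by rewrite /beta; lra.
have e2b : e2 * beta <= A * u * ((21 / 4 * (1 + A) + 5 / 4 * A) * u) by rewrite ler_pM.
rewrite mulrDr mulr1.
(* The u^2 terms are [B] from [e2], the bound on [e2 * beta], 21/4 [A] from [uw * e1] and 5/4 [B]
   from [e1]; to first order, u_q gets 2 + (5/4) 2 = 9/2. *)
have : beta <= 21 / 4 * uw + 21 / 4 * (A * u ^+ 2) + 5 / 4 * (g1 + 2 * u + B * u ^+ 2).
  by rewrite /beta; lra.
lra.
Qed.

Theorem theorem4p2 (R : realType) (gMM : nat -> R -> R)
    (gMM_ge0 : forall k, \forall u \near 0^'+, 0 <= gMM k u)
    (gMM_order1 : forall k, gMM k =O_ (0^'+) id)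
    (d D : nat) (Wup : 'M[R]_(D, d)) (Wdown : 'M[R]_(d, D)) (x : 'cV[R]_d) :
  exists2 e : R -> R, e =O_ (0^'+) (fun u => u ^+ 2) &
    \forall uq \near 0^'+, forall (uw ua : R),
      0 < uw -> uw <= ua -> ua <= uq ->
      forall z : 'cV[R]_d, fl_mlp gMM uw ua uq Wup Wdown x z ->
      forall i j,
        absmx (z - mlp Wup Wdown x) i j <=
          (21 / 4 * uw + 9 / 2 * uq + 5 / 4 * gMM d ua + gMM D ua + e uq)
          * (absmx Wdown *m absmx Wup *m absmx x) i j.

Proof.
have /eqO_exP[C1 C10 /near_right0_ex[r1 r10 hC1]] := gMM_order1 d.
have /eqO_exP[C2 C20 /near_right0_ex[r2 r20 hC2]] := gMM_order1 D.
have /near_right0_ex[r3 r30 hg1] := gMM_ge0 d.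
have /near_right0_ex[r4 r40 hg2] := gMM_ge0 D.
pose C := Num.max C1 C2.
have C0 : 0 <= C by rewrite le_max ltW.
pose A := 5 * C + 4; pose B := 4 * C + 8.
pose K := B + A * (21 / 4 * (1 + A) + 5 / 4 * A) + 21 / 4 * A + 5 / 4 * B.
exists (fun u => K * u ^+ 2); first exact: scale_sqr_eqO.
near=> uq => uw ua uw0 uwa uaq z [y [a [yE aE zE]]] i j.
have ua0 : 0 < ua by exact: lt_le_trans uwa.
have uwq : uw <= uq by exact: le_trans uaq.
have uq0 : 0 <= uq by apply: le_trans uwq; exact: ltW.
have uq1 : uq <= 1 / 1000 by near: uq; apply: nbhs_right_le; lra.
(* Since 0 < [ua] <= [uq], the first-order bound at [ua] becomes one in [uq]. *)
have gb k r r' Ck : 0 < Ck -> (forall u, 0 < u -> u < r -> `|gMM k u| <= Ck * `|u|) ->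
    (forall u, 0 < u -> u < r' -> 0 <= gMM k u) -> Ck <= C ->
    uq < r -> uq < r' -> 0 <= gMM k ua <= C * uq.
  move=> Ck0 hC hg CkC ur ur'; rewrite hg ?(le_lt_trans uaq)//=.
  apply: le_trans (ler_norm _) _.
  apply: le_trans (hC _ ua0 (le_lt_trans uaq ur)) _.
  by rewrite gtr0_norm// ler_pM// ?(ltW Ck0) ?(ltW ua0).
have g1 : 0 <= gMM d ua <= C * uq.
  apply: (gb _ _ _ _ C10 hC1 hg1); rewrite ?le_max ?lexx//;
  by near: uq; exact: nbhs_right_lt.
have g2 : 0 <= gMM D ua <= C * uq.
  apply: (gb _ _ _ _ C20 hC2 hg2); rewrite ?le_max ?lexx ?orbT//;
  by near: uq; exact: nbhs_right_lt.
have uwq' : 0 <= uw <= uq by rewrite ltW.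
have uq4 : uq <= 1 / 4 by lra.
have [] := mlp_error_expansion R C uw uq _ _ _ C0 uwq' uq4
  (gamma2_bounds R uq uq0 uq4) g1 g2.
set e1 := gMM d ua + _ + _; set e2 := gMM D ua + _ + _.
set beta := 21 / 4 * uw * _ + _ => e10 e20 beta0 bound.
pose V := absmx Wup *m absmx x.
have V0 l : 0 <= V l j by rewrite mxE sumr_ge0// => q _; rewrite mulr_ge0 ?absmx_ge0.
have yV l : `|y l j - (Wup *m x) l j| <= e1 * V l j.
  by have := yE l j; rewrite [absmx _ _ _]mxE !mxE.
have WV l : `|(Wup *m x) l j| <= V l j.
  by have := absmx_mulmx_le _ _ _ _ Wup x l j; rewrite [absmx _ _ _]mxE.
have aV l : absmx (a - map_mx (@gelu R) (Wup *m x)) l j <= beta * V l j.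
  rewrite 3!mxE [map_mx _ _ _ _]mxE.
  (* Inserting [gelu] of the computed [y] separates the evaluation error from the propagated error
     of the first product. *)
  rewrite -(subrKA (gelu (y l j))); apply: le_trans (ler_normD _ _) _.
  have uw1 : uw <= 1 / 1000 by lra.
  have := fl_gelu_error _ _ _ _ uw1 (aE l j).
  have := gelu_lipschitz _ ((Wup *m x) l j) (y l j).
  have : `|y l j| <= (1 + e1) * V l j.
    rewrite -(subrK ((Wup *m x) l j) (y l j)); apply: le_trans (ler_normD _ _) _.
    by have := yV l; have := WV l; lra.
  move=> yl /le_trans-/(_ (5 / 4 * (e1 * V l j))) lip.
  move=> /le_trans-/(_ (21 / 4 * uw * ((1 + e1) * V l j))) fe.
  have -> : beta * V l j = 21 / 4 * uw * ((1 + e1) * V l j) + 5 / 4 * (e1 * V l j).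
    by rewrite /beta; ring.
  by rewrite lerD ?fe ?lip ?ler_wpM2l// mulr_ge0// ltW.
have aV' l : absmx a l j <= (1 + beta) * V l j.
  rewrite -(subrK (map_mx (@gelu R) (Wup *m x)) a) mxE mxE mulrDl mul1r addrC.
  apply: le_trans (ler_normD _ _) _.
  have := aV l; rewrite [absmx _ _ _]mxE; apply: lerD.
  by rewrite mxE; apply: le_trans (gelu_norm_le _ _) (WV l).
rewrite -mulmxA -/V.
have WdV0 : 0 <= (absmx Wdown *m V) i j.
  by rewrite mxE sumr_ge0// => q _; rewrite mulr_ge0 ?absmx_ge0.
apply: le_trans (ler_wpM2r WdV0 bound).
(* The rounding of the second product is separated from the hidden-layer error carried through
   [Wdown]; they contribute [e2 * (1 + beta)] and [beta]. *)
have -> : z - mlp Wup Wdown x =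
    (z - Wdown *m a) + Wdown *m (a - map_mx (@gelu R) (Wup *m x)).
  by rewrite mulmxBr addrA subrK.
rewrite 2!mxE; apply: le_trans (ler_normD _ _) _; rewrite mulrDl; apply: lerD.
  have := zE i j; rewrite [absmx _ _ _]mxE => /le_trans; apply.
  by rewrite -mulrA ler_wpM2l// absmx_mulmx_ler.
have := absmx_mulmx_le _ _ _ _ Wdown (a - map_mx (@gelu R) (Wup *m x)) i j.
rewrite [absmx _ _ _]mxE => /le_trans; apply.
exact: absmx_mulmx_ler.
Unshelve. all: by end_near.
Qed.
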